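(* The action of $\mathfrak{S}_4$ on $F_4$ is homotopically trivial, i.e. each $\sigma\in\mathfrak{S}_4$ acts on $F_4$ by a map homotopic to the identity. In particular, $H^*(F_4;\mathbb{Q})\cong H^*(\mathrm{PGL}_3(\mathbb{C});\mathbb{Q})$ is trivial as an $\mathfrak{S}_4$-representation.
   Context: $F_4\subset(\mathbb{CP}^2)^4$ is the space of ordered $4$-tuples of distinct points of $\mathbb{CP}^2$, no three of which lie on a line. $\mathfrak{S}_4$ acts on $F_4$ by permuting coordinates, and $\mathrm{PGL}_3(\mathbb{C})$ acts on $F_4$ diagonally. The isomorphism $H^*(F_4;\mathbb{Q})\cong H^*(\mathrm{PGL}_3(\mathbb{C});\mathbb{Q})$ is induced by the orbit map $\mathrm{PGL}_3(\mathbb{C})\to F_4$, $g\mapsto g\cdot x$, for a basepoint $x\in F_4$, which is a homeomorphism. *)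

(* Defs.v *)
From HB Require Import structures.
From mathcomp Require Import all_boot all_order perm all_algebra complex.
From mathcomp Require Import all_classical all_reals topology normedtype.

Set Implicit Arguments.
Unset Strict Implicit.
Unset Printing Implicit Defensive.

Import Order.TTheory GRing.Theory Num.Theory numFieldNormedType.Exports.

Local Open Scope classical_set_scope.
Local Open Scope quotient_scope.
Local Open Scope ring_scope.

Definition homotopic (R : realType) (X Y : topologicalType) (f g : X -> Y) :=
  exists H : X * R -> Y,
    [/\ {within [set: X] `*` `[0, 1], continuous H},
        (forall x, H (x, 0) = f x) &
        (forall x, H (x, 1) = g x)].

Lemma continuous_prod_topology (I : Type) (X : topologicalType)
    (Y : I -> topologicalType) (f : X -> prod_topology Y) :
  (forall i, continuous (fun x => f x i)) -> continuous f.
Proof.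
move=> cf x; apply/cvg_sup => i.
exact: (@continuous_comp_initial _ _ _ (fun p : forall i, Y i => p i) f).
Qed.

Lemma continuous_matrix (T X : topologicalType) m n (f : X -> 'M[T]_(m, n)) :
  (forall i j, continuous (fun x => f x i j)) -> continuous f.
Proof.
move=> cf x U [P Px PU].
suff near_all (s : seq ('I_m * 'I_n)) :
    \forall y \near x, forall ij, ij \in s -> P ij.1 ij.2 (f y ij.1 ij.2).
  apply: filterS (near_all (enum {: 'I_m * 'I_n})) => y Py; apply: PU => i j.
  by apply: (Py (i, j)); rewrite mem_enum.
elim: s => [|ij s IHs]; first by apply: nearW.
have Pij : \forall y \near x, P ij.1 ij.2 (f y ij.1 ij.2).
  exact: (cf ij.1 ij.2 x _ (Px ij.1 ij.2)).
apply: filterS (filterI Pij IHs) => y [Py IHy] kl.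
by rewrite inE => /predU1P[->//|]; exact: IHy.
Qed.

Section QuotientModule.
Variables (A : pzRingType) (V : lmodType A) (S : {pred V}).
Hypothesis closedS : submod_closed S.

Definition submod_mem of submod_closed S : {pred V} := S.

HB.instance Definition _ :=
  GRing.isZmodClosed.Build V (submod_mem closedS)
    (GRing.submod_closedB closedS).

(* [Quotient.quot] is only the quotient of additive groups: the scaling is added
   below *)
Definition quot_mod : Type := Quotient.quot (submod_mem closedS).

HB.instance Definition _ := GRing.Zmodule.on quot_mod.
HB.instance Definition _ := Quotient.on quot_mod.

Lemma eq_quot_mod (x y : V) :
  \pi_quot_mod x = \pi_quot_mod y <-> x - y \in S.
Proof.
rewrite -[x - y \in S]/(x - y \in submod_mem closedS).
by rewrite Quotient.idealrBE; split => /eqP.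
Qed.

Lemma pi_quot_modD : {morph \pi_quot_mod : x y / x + y}.
Proof. exact: Quotient.pi_add. Qed.

Definition quot_scale (a : A) (z : quot_mod) : quot_mod :=
  \pi_quot_mod (a *: repr z).

Lemma pi_quot_modZ a : {morph \pi_quot_mod : x / a *: x >-> quot_scale a x}.
Proof.
move=> x; apply/eq_quot_mod; rewrite -scalerBr.
apply: (GRing.submod_closed_semi closedS).2.
by apply/eq_quot_mod; rewrite reprK.
Qed.

Let scaleA a b z : quot_scale a (quot_scale b z) = quot_scale (a * b) z.
Proof. by rewrite -[z]reprK -!pi_quot_modZ scalerA reprK. Qed.

Let scale1 : left_id 1 quot_scale.
Proof. by move=> z; rewrite -[z]reprK -pi_quot_modZ scale1r. Qed.

Let scaleDr : right_distributive quot_scale +%R.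
Proof.
move=> a y z; rewrite -[y]reprK -[z]reprK.
by rewrite -pi_quot_modD -!pi_quot_modZ -pi_quot_modD scalerDr.
Qed.

Let scaleDl z : {morph quot_scale^~ z : a b / a + b}.
Proof.
by move=> a b; rewrite -[z]reprK -!pi_quot_modZ -pi_quot_modD scalerDl.
Qed.

HB.instance Definition _ := GRing.Zmodule_isLmodule.Build A quot_mod
  scaleA scale1 scaleDr scaleDl.

Lemma pi_quot_mod_linear : linear \pi_quot_mod.
Proof. by move=> a x y; rewrite pi_quot_modD pi_quot_modZ. Qed.

End QuotientModule.

Section Simplices.
Variable R : realType.

Definition simplex (n : nat) : set 'rV[R]_n.+1 :=
  [set t | (forall i, 0 <= t 0 i) /\ \sum_i t 0 i = 1].
Arguments simplex : clear implicits.

(* [face i] inserts a zero at the [i]-th barycentric coordinate *)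
Definition face_row n (i : 'I_n.+2) (t : 'rV[R]_n.+1) : 'rV[R]_n.+2 :=
  \row_j (if unlift i j is Some k then t 0 k else 0).

Lemma face_subproof n (i : 'I_n.+2) (t : simplex n) :
  face_row i (val t) \in simplex n.+1.
Proof.
case: t => t /= /[!inE] -[t0 t1]; split=> [j|].
  by rewrite mxE; case: unlift.
rewrite (bigD1_ord i)//= mxE unlift_none add0r -[RHS]t1.
by apply: eq_bigr => j _; rewrite mxE liftK.
Qed.

Definition face n (i : 'I_n.+2) (t : simplex n) : simplex n.+1 :=
  Sub (face_row i (val t)) (face_subproof i t).

Lemma face_continuous n (i : 'I_n.+2) : continuous (face i).
Proof.
apply: continuous_comp_initial => /=.
apply: continuous_matrix => k j.
rewrite (_ : (fun t => _) =
  fun t : simplex n => if unlift i j is Some l then val t 0 l else 0).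
  case: unlift => [l|]; last exact: cst_continuous.
  move=> x.
  apply: (@continuous_comp (simplex n) _ _ val (fun t : 'rV[R]_n.+1 => t 0 l)).
    exact: initial_continuous.
  exact: coord_continuous.
by apply/funext => t; rewrite /= mxE.
Qed.

HB.instance Definition _ n (i : 'I_n.+2) :=
  isContinuous.Build _ _ (face i) (@face_continuous n i).

End Simplices.
Arguments simplex : clear implicits.

Section SingularCohomology.
Variables (R : realType) (A : comNzRingType).

Definition sing_simplex (n : nat) (X : topologicalType) : Type :=
  continuousType (simplex R n) X.

Definition cochain n X : Type := sing_simplex n X -> A^o.
HB.instance Definition _ n X := GRing.Lmodule.on (cochain n X).

Section Space.
Variable X : topologicalType.

Definition codiff n (c : cochain n X) : cochain n.+1 X :=
  fun s => \sum_(i < n.+2) (-1) ^+ i * c (s \o face i).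

Lemma codiff_linear n : linear (@codiff n).
Proof.
move=> a c d; apply/funext => s; rewrite /codiff.
rewrite -[RHS]/(a * _ + _) mulr_sumr -big_split; apply: eq_bigr => i _ /=.
by rewrite -[(a *: c + d) _]/(a * c _ + d _) mulrDr mulrCA.
Qed.

HB.instance Definition _ n :=
  GRing.isLinear.Build A (cochain n X) (cochain n.+1 X) _ (@codiff n)
    (@codiff_linear n).

Definition is_cocycle n (c : cochain n X) : bool := `[< codiff c = 0 >].

Lemma is_cocycle_closed n : subsemimod_closed (@is_cocycle n : {pred _}).
Proof.
split; first split.
- by apply/asboolP; rewrite linear0.
- move=> c d /asboolP c0 /asboolP d0; apply/asboolP.
  by rewrite linearD /= c0 d0 addr0.
- by move=> a c /asboolP c0; apply/asboolP; rewrite linearZ /= c0 scaler0.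
Qed.

Definition cocycle n : Type := {c : cochain n X | is_cocycle c}.
HB.instance Definition _ n := SubChoice.on (cocycle n).
HB.instance Definition _ n := GRing.SubChoice_isSubLmodule.Build A
  (cochain n X) (@is_cocycle n) (cocycle n) (@is_cocycle_closed n).

Definition coboundary n : {pred cocycle n} :=
  match n with
  | 0 => fun z => z == 0
  | m.+1 => fun z => `[< exists b : cochain m X, val z = codiff b >]
  end.

Lemma coboundary_closed n : submod_closed (@coboundary n).
Proof.
case: n => [|n]; split.
- by rewrite unfold_in /=.
- by move=> a y z /eqP-> /eqP->; rewrite unfold_in /= scaler0 addr0.
- by apply/asboolP; exists 0; rewrite !linear0.
- move=> a y z /asboolP[b yb] /asboolP[c zc]; apply/asboolP.
  by exists (a *: b + c); rewrite !linearP /= yb zc.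
Qed.

Definition cohomology n : Type := quot_mod (@coboundary_closed n).
HB.instance Definition _ n := GRing.Lmodule.on (cohomology n).
HB.instance Definition _ n := Quotient.on (cohomology n).

Lemma eq_cohomology n (y z : cocycle n) :
  \pi_(cohomology n) y = \pi_(cohomology n) z <-> y - z \in @coboundary n.
Proof. exact: (eq_quot_mod (coboundary_closed n)). Qed.

Lemma pi_cohomology_linear n : linear \pi_(cohomology n).
Proof. exact: (pi_quot_mod_linear (coboundary_closed n)). Qed.

End Space.

Section InducedMap.
Variables (X Y : topologicalType) (f : continuousType X Y).

Definition cochain_map n (c : cochain n Y) : cochain n X := fun s => c (f \o s).

Lemma cochain_map_linear n : linear (@cochain_map n).
Proof. by []. Qed.

HB.instance Definition _ n :=
  GRing.isLinear.Build A (cochain n Y) (cochain n X) _ (@cochain_map n)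
    (@cochain_map_linear n).

Lemma codiff_cochain_map n (c : cochain n Y) :
  codiff (cochain_map c) = cochain_map (codiff c).
Proof.
apply/funext => s; apply: eq_bigr => i _; congr (_ * c _).
exact/continuousEP.
Qed.

Lemma cocycle_map_subproof n (z : cocycle Y n) :
  is_cocycle (cochain_map (val z)).
Proof.
by apply/asboolP; rewrite codiff_cochain_map (asboolP _ (valP z)) linear0.
Qed.

Definition cocycle_map n (z : cocycle Y n) : cocycle X n :=
  Sub (cochain_map (val z)) (cocycle_map_subproof z).

Lemma cocycle_map_linear n : linear (@cocycle_map n).
Proof. by move=> a y z; apply: val_inj; rewrite /= !linearP. Qed.

HB.instance Definition _ n :=
  GRing.isLinear.Build A (cocycle Y n) (cocycle X n) _ (@cocycle_map n)
    (@cocycle_map_linear n).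

Lemma coboundary_map n (z : cocycle Y n) :
  z \in @coboundary Y n -> cocycle_map z \in @coboundary X n.
Proof.
case: n z => [|n] z.
  by rewrite !unfold_in => /eqP->; rewrite linear0.
move=> /asboolP[b zb]; apply/asboolP; exists (cochain_map b).
by rewrite codiff_cochain_map -zb.
Qed.

Definition cohomology_map n (h : cohomology Y n) : cohomology X n :=
  \pi_(cohomology X n) (cocycle_map (repr h)).

Lemma cohomology_map_pi n (z : cocycle Y n) :
  cohomology_map (\pi_(cohomology Y n) z) =
  \pi_(cohomology X n) (cocycle_map z).
Proof.
apply/eq_cohomology; rewrite -linearB; apply: coboundary_map.
by apply/eq_cohomology; rewrite reprK.
Qed.

Lemma cohomology_map_linear n : linear (@cohomology_map n).
Proof.
move=> a y z; rewrite -[y]reprK -[z]reprK -pi_cohomology_linear.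
by rewrite !cohomology_map_pi -pi_cohomology_linear linearP.
Qed.

HB.instance Definition _ n :=
  GRing.isLinear.Build A (cohomology Y n) (cohomology X n) _
    (@cohomology_map n) (@cohomology_map_linear n).

End InducedMap.

End SingularCohomology.
Arguments cohomology_map {R A X Y} f {n} h.

Section Projective.
Variable K : numFieldType.

Definition nonzero_vec (n : nat) : set 'cV[K]_n := [set v | v != 0].
Arguments nonzero_vec : clear implicits.

Definition prop_vec n (u v : nonzero_vec n) : bool :=
  `[< exists2 c : K, c != 0 & val v = c *: val u >].

Lemma prop_vec_equiv n : equiv_class_of (@prop_vec n).
Proof.
apply: EquivClass => [u|u v|v u w].
- by apply/asboolP; exists 1; rewrite ?oner_neq0// scale1r.
- suff H (x y : nonzero_vec n) : prop_vec x y -> prop_vec y x.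
    by apply/idP/idP; exact: H.
  move=> /asboolP[c c0 yx]; apply/asboolP; exists c^-1; rewrite ?invr_eq0//.
  by rewrite yx scalerA mulVf// scale1r.
- move=> /asboolP[c c0 uv] /asboolP[d d0 vw]; apply/asboolP.
  by exists (d * c); rewrite ?mulf_neq0// vw uv scalerA.
Qed.

Canonical prop_vec_equivRel n := EquivRelPack (@prop_vec_equiv n).
Canonical prop_vec_encModRel n := defaultEncModRel (@prop_vec n).

(* lines of [K ^ (n + 1)], with the quotient topology *)
Definition proj_space (n : nat) : Type :=
  quotient_topology {eq_quot @prop_vec n.+1}.
HB.instance Definition _ n := Topological.on (proj_space n).
HB.instance Definition _ n := Quotient.on (proj_space n).

Definition GL (n : nat) : set 'M[K]_n := [set A | A \in unitmx].
Arguments GL : clear implicits.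

Definition prop_mx n (A B : GL n) : bool :=
  `[< exists2 c : K, c != 0 & val B = c *: val A >].

Lemma prop_mx_equiv n : equiv_class_of (@prop_mx n).
Proof.
apply: EquivClass => [A|A B|B A C].
- by apply/asboolP; exists 1; rewrite ?oner_neq0// scale1r.
- suff H (X Y : GL n) : prop_mx X Y -> prop_mx Y X.
    by apply/idP/idP; exact: H.
  move=> /asboolP[c c0 YX]; apply/asboolP; exists c^-1; rewrite ?invr_eq0//.
  by rewrite YX scalerA mulVf// scale1r.
- move=> /asboolP[c c0 AB] /asboolP[d d0 BC]; apply/asboolP.
  by exists (d * c); rewrite ?mulf_neq0// BC AB scalerA.
Qed.

Canonical prop_mx_equivRel n := EquivRelPack (@prop_mx_equiv n).
Canonical prop_mx_encModRel n := defaultEncModRel (@prop_mx n).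

Definition PGL (n : nat) : Type := quotient_topology {eq_quot @prop_mx n}.
HB.instance Definition _ n := Topological.on (PGL n).
HB.instance Definition _ n := Quotient.on (PGL n).

Lemma GL_act_subproof n (A : GL n) (v : nonzero_vec n) :
  val A *m val v \in nonzero_vec n.
Proof.
have /[!inE] uA : val A \in GL n := valP A.
have /[!inE] v0 : val v \in nonzero_vec n := valP v.
by apply: contra_neq v0 => Av0; rewrite -[val v](mulKmx uA) Av0 mulmx0.
Qed.

Definition GL_act n (A : GL n) (v : nonzero_vec n) : nonzero_vec n :=
  Sub (val A *m val v) (GL_act_subproof A v).

Definition PGL_act n (g : PGL n.+1) (p : proj_space n) : proj_space n :=
  \pi_(proj_space n) (GL_act (repr g) (repr p)).

Lemma proj_spaceE n (u v : nonzero_vec n.+1) :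
  \pi_(proj_space n) u = \pi_(proj_space n) v <-> prop_vec u v.
Proof. by split=> [/eqmodP|uv]; last exact/eqmodP. Qed.

Lemma PGLE n (A B : GL n) : \pi_(PGL n) A = \pi_(PGL n) B <-> prop_mx A B.
Proof. by split=> [/eqmodP|AB]; last exact/eqmodP. Qed.

Lemma PGL_act_pi n (A : GL n.+1) (v : nonzero_vec n.+1) :
  PGL_act (\pi_(PGL n.+1) A) (\pi_(proj_space n) v) =
  \pi_(proj_space n) (GL_act A v).
Proof.
have /PGLE/asboolP[c c0 Ac] :
  \pi_(PGL n.+1) (repr (\pi_(PGL n.+1) A)) = \pi_(PGL n.+1) A.
  by rewrite reprK.
have /proj_spaceE/asboolP[d d0 vd] :
  \pi_(proj_space n) (repr (\pi_(proj_space n) v)) = \pi_(proj_space n) v.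
  by rewrite reprK.
apply/proj_spaceE/asboolP; exists (c * d); first exact: mulf_neq0.
by rewrite /= Ac vd -scalemxAl -scalemxAr scalerA.
Qed.

(* the line with equation [l *m v = 0], see [proj_line_pi] for the independence
   of the representative *)
Definition proj_line (l : 'rV[K]_3) : set (proj_space 2) :=
  [set p | l *m val (repr p) = 0].

Definition collinear (p q r : proj_space 2) : Prop :=
  exists2 l : 'rV[K]_3, l != 0 &
    [/\ proj_line l p, proj_line l q & proj_line l r].

Lemma proj_line_pi (l : 'rV[K]_3) (v : nonzero_vec 3) :
  proj_line l (\pi_(proj_space 2) v) <-> l *m val v = 0.
Proof.
have /proj_spaceE/asboolP[c c0 vc] :
  \pi_(proj_space 2) (repr (\pi_(proj_space 2) v)) = \pi_(proj_space 2) v.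
  by rewrite reprK.
rewrite /proj_line /= vc -scalemxAr; split=> [->|/eqP]; first exact: scaler0.
by rewrite scaler_eq0 (negPf c0) => /eqP.
Qed.

Lemma PGL_act_inj n (g : PGL n.+1) : injective (PGL_act g).
Proof.
move=> p q; rewrite -[g]reprK -[p]reprK -[q]reprK !PGL_act_pi.
move=> /proj_spaceE/asboolP[c c0 gqp].
apply/proj_spaceE/asboolP; exists c => //.
have /[!inE] ug : val (repr g) \in GL n.+1 := valP (repr g).
by rewrite -[LHS](mulKmx ug) [X in _ *m X]gqp /= -scalemxAr mulKmx.
Qed.

Lemma PGL_act_line (g : PGL 3) (l : 'rV[K]_3) (p : proj_space 2) :
  proj_line l (PGL_act g p) <-> proj_line (l *m val (repr g)) p.
Proof. by rewrite /PGL_act proj_line_pi /= mulmxA. Qed.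

Lemma PGL_act_collinear (g : PGL 3) (p q r : proj_space 2) :
  collinear (PGL_act g p) (PGL_act g q) (PGL_act g r) -> collinear p q r.
Proof.
move=> [l l0 [/PGL_act_line lp /PGL_act_line lq /PGL_act_line lr]].
exists (l *m val (repr g)) => //.
have /[!inE] ug : val (repr g) \in GL 3 := valP (repr g).
by apply: contra_neq l0 => lg0; rewrite -[l](mulmxK ug) lg0 mul0mx.
Qed.

Lemma PGL_act_continuous n (p : proj_space n) :
  continuous (fun g : PGL n.+1 => PGL_act g p).
Proof.
apply/quotient_continuous.
rewrite (_ : _ \o _ = \pi_(proj_space n) \o (fun A => GL_act A (repr p)));
  last first.
  by apply/funext => A; rewrite /= -[in LHS](reprK p) PGL_act_pi.
move=> A; apply: continuous_comp; last exact: pi_continuous.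
move: A; apply: continuous_comp_initial; apply: continuous_matrix => i j.
rewrite (_ : (fun A => _) =
  fun A : GL n.+1 => \sum_k val A i k * val (repr p) k j); last first.
  by apply/funext => A; rewrite /= mxE.
apply: continuous_big => [|k _]; first exact: add_continuous.
have cA : continuous (fun A : GL n.+1 => val A i k).
  move=> A.
  apply: (@continuous_comp (GL n.+1) _ _ val (fun B : 'M[K]_n.+1 => B i k)).
    exact: initial_continuous.
  exact: coord_continuous.
by move=> A; apply: continuousM; [exact: cA|exact: cst_continuous].
Qed.

Definition F4 : set (prod_topology (fun _ : 'I_4 => proj_space 2)) :=
  [set x : 'I_4 -> proj_space 2 |
     injective x /\
     forall i j k : 'I_4, uniq [:: i; j; k] ->
       ~ collinear (x i) (x j) (x k)].

Lemma F4_perm_subproof (s : 'S_4) (x : F4) :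
  (fun i => val x (s^-1%g i)) \in F4.
Proof.
have /[!inE] -[x_inj x_gen] : val x \in F4 := valP x.
split=> [i j /x_inj/perm_inj//|i j k ijk]; apply: x_gen.
rewrite -[[:: _; _; _]]/(map s^-1%g [:: i; j; k]) map_inj_uniq//.
exact: perm_inj.
Qed.

(* the [i]-th point of [x] becomes the [s i]-th one *)
Definition F4_perm (s : 'S_4) (x : F4) : F4 :=
  exist _ (fun i => val x (s^-1%g i)) (F4_perm_subproof s x).

Lemma F4_coord_continuous (i : 'I_4) : continuous (fun x : F4 => val x i).
Proof.
move=> x; apply: (@continuous_comp F4 _ _ val (fun y => proj i y)).
  exact: initial_continuous.
exact: proj_continuous.
Qed.

Lemma F4_perm_continuous s : continuous (F4_perm s).
Proof.
apply: continuous_comp_initial; apply: continuous_prod_topology => i.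
exact: F4_coord_continuous.
Qed.

HB.instance Definition _ s :=
  isContinuous.Build _ _ (F4_perm s) (@F4_perm_continuous s).

Lemma F4_act_subproof (g : PGL 3) (x : F4) :
  (fun i => PGL_act g (val x i)) \in F4.
Proof.
have /[!inE] -[x_inj x_gen] : val x \in F4 := valP x.
split=> [i j /PGL_act_inj/x_inj//|i j k ijk /PGL_act_collinear]; exact: x_gen.
Qed.

Definition F4_act (g : PGL 3) (x : F4) : F4 :=
  exist _ (fun i => PGL_act g (val x i)) (F4_act_subproof g x).

Definition orbit_map (x : F4) (g : PGL 3) : F4 := F4_act g x.

Lemma orbit_map_continuous x : continuous (orbit_map x).
Proof.
apply: continuous_comp_initial; apply: continuous_prod_topology => i.
exact: PGL_act_continuous.
Qed.

HB.instance Definition _ x :=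
  isContinuous.Build _ _ (orbit_map x) (@orbit_map_continuous x).

End Projective.
Arguments F4 : clear implicits.
Arguments PGL : clear implicits.

(* Main.v *)
Require Import Defs.
From HB Require Import structures.
From mathcomp Require Import all_boot all_order perm all_algebra complex.
From mathcomp Require Import all_classical all_reals topology normedtype.
From mathcomp Require Import zify.

(* The frame matrix of a point of F_4, which sends the standard frame e_1, e_2,
   e_3, e_1 + e_2 + e_3 to its four lines, is unique up to a scalar and is
   polynomial in the homogeneous coordinates; hence the orbit maps are
   homeomorphisms, as the projection onto projective space is open. The
   permutations commute with PGL_3, so that they read as right translations of
   PGL_3, which are homotopic to the identity because GL_3(C) is path connected.
   Cohomology is homotopy invariant by the prism operator. *)

Set Implicit Arguments.
Unset Strict Implicit.
Unset Printing Implicit Defensive.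

Import Order.TTheory GRing.Theory Num.Theory numFieldNormedType.Exports.

Local Open Scope classical_set_scope.
Local Open Scope quotient_scope.
Local Open Scope ring_scope.

Section Push.
Variable R : realType.

Definition push_row m n (th : 'I_m.+1 -> 'I_n.+1) (t : 'rV[R]_m.+1) :
    'rV[R]_n.+1 :=
  \row_k \sum_(l | th l == k) t 0 l.

Lemma push_subproof m n (th : 'I_m.+1 -> 'I_n.+1) (t : simplex R m) :
  push_row th (val t) \in simplex R n.
Proof.
case: t => t /= /[!inE] -[t0 t1]; split=> [k|].
  by rewrite mxE sumr_ge0.
rewrite -[RHS]t1 (partition_big th xpredT)//=.
by apply: eq_bigr => k _; rewrite mxE.
Qed.

Definition push m n (th : 'I_m.+1 -> 'I_n.+1) (t : simplex R m) : simplex R n :=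
  Sub (push_row th (val t)) (push_subproof th t).

Lemma pushE m n (th : 'I_m.+1 -> 'I_n.+1) (t : simplex R m) k :
  val (push th t) 0 k = \sum_(l | th l == k) val t 0 l.
Proof. by rewrite mxE. Qed.

Lemma simplexP n (t u : simplex R n) :
  (forall k, val t 0 k = val u 0 k) -> t = u.
Proof. by move=> tu; apply/val_inj/rowP. Qed.

Lemma faceE n (i : 'I_n.+2) : face i = push (lift i) :> (simplex R n -> _).
Proof.
apply/funext => t; apply: simplexP => k; rewrite pushE mxE.
case: unliftP => [l ->|->].
  by rewrite (big_pred1 l)// => j; rewrite (inj_eq lift_inj).
by rewrite big_pred0// => j; rewrite eq_sym (negPf (neq_lift _ _)).
Qed.

Lemma push_id n (t : simplex R n) : push id t = t.
Proof.
by apply: simplexP => k; rewrite pushE (big_pred1 k).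
Qed.

Lemma push_sum m n (th : 'I_m.+1 -> 'I_n.+1) (p : pred 'I_n.+1) t :
  \sum_(k | p k) val (push th t) 0 k = \sum_(l | p (th l)) val t 0 l.
Proof.
rewrite (partition_big th p)//=; apply: eq_bigr => k pk; rewrite pushE.
by apply: eq_bigl => l; case: eqP => [->|]; rewrite ?pk ?andbF.
Qed.

Lemma push_comp k m n (th : 'I_m.+1 -> 'I_n.+1) (ph : 'I_k.+1 -> 'I_m.+1) t :
  push th (push ph t) = push (th \o ph) t.
Proof.
by apply: simplexP => i; rewrite !pushE (push_sum ph (fun l => th l == i)).
Qed.

Lemma sum_simplex_continuous n (p : pred 'I_n.+1) :
  continuous (fun t : simplex R n => \sum_(l | p l) val t 0 l).
Proof.
apply: continuous_big => [|l _]; first exact: add_continuous.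
move=> x.
apply: (@continuous_comp (simplex R n) _ _ val (fun t : 'rV[R]_n.+1 => t 0 l)).
  exact: initial_continuous.
exact: coord_continuous.
Qed.

Lemma push_continuous m n (th : 'I_m.+1 -> 'I_n.+1) : continuous (push th).
Proof.
apply: continuous_comp_initial; apply: continuous_matrix => i k.
rewrite (_ : (fun t => _) =
  fun t : simplex R m => \sum_(l | th l == k) val t 0 l).
  exact: sum_simplex_continuous.
by apply/funext => t; rewrite /= mxE.
Qed.

Lemma sum_simplex_itv n (p : pred 'I_n.+1) (t : simplex R n) :
  `[0, 1]%classic (\sum_(l | p l) val t 0 l).
Proof.
case: t => t /= /[!inE] -[t0 t1]; apply/andP; rewrite !bnd_simp sumr_ge0//.
by split=> //; rewrite -t1 [leRHS](bigID p)/= lerDl sumr_ge0.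
Qed.

End Push.

(* [D i j] and [E j i] stand for the [i]-th face of the [j]-th piece of the
   prism and for the [j]-th piece of the prism over the [i]-th face. *)
Lemma prism_sum (A : comPzRingType) (D E : nat -> nat -> A) n :
  (forall i j, (i < j)%N -> D i j = E j.-1 i) ->
  (forall j, D j.+1 j.+1 = D j.+1 j) ->
  (forall i j, (j.+1 < i)%N -> D i j = E j i.-1) ->
  \sum_(j < n.+1) (-1) ^+ j * (\sum_(i < n.+2) (-1) ^+ i * D i j) =
  D 0 0 - D n.+1 n -
    \sum_(i < n.+1) (-1) ^+ i * (\sum_(j < n) (-1) ^+ j * E j i).
Proof.
move=> Dlt Deq Dgt.
pose G i j : A := (-1) ^+ (i + j) * E j i.
have pieceE (j : 'I_n.+1) :
    (-1) ^+ j * (\sum_(i < n.+2) (-1) ^+ i * D i j) =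
    D j j - D j.+1 j +
    (\sum_(0 <= i < j) (-1) ^+ (i + j) * E j.-1 i -
     \sum_(j.+1 <= i < n.+1) G i j).
  rewrite -(big_mkord xpredT (fun i => (-1) ^+ i * D i j)) mulr_sumr.
  under eq_bigr do rewrite mulrA -exprD addnC.
  have jn := ltn_ord j.
  rewrite (big_cat_nat (n := j))//= 1?ltnW 1?ltnW// addrC.
  rewrite big_ltn 1?ltnW// big_ltn// big_add1 /= addnn addSn addnn exprS.
  rewrite -signr_odd odd_double mul1r mulr1 mulN1r addrA -addrA.
  congr (_ + _); rewrite addrC -sumrN; congr (_ + _).
    by rewrite !big_nat; apply: eq_bigr => i /= ij; rewrite Dlt.
  rewrite !big_nat; apply: eq_bigr => i /andP[ji _].
  by rewrite Dgt// addSn exprS !mulN1r mulNr.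
rewrite (eq_bigr _ (fun j _ => pieceE j)) big_split /=; congr (_ + _).
  rewrite -(big_mkord xpredT (fun j => D j j - D j.+1 j)).
  rewrite big_nat_recr//= addrA; congr (_ - _).
  rewrite sumrB addrAC; apply/eqP; rewrite subr_eq -big_nat_recr//=.
  by rewrite big_nat_recl//=; apply/eqP; congr (_ + _); apply: eq_bigr.
under [in RHS]eq_bigr do rewrite mulr_sumr.
rewrite sumrB big_ord_recl big_geq// add0r [X in _ - X]big_ord_recr /=.
rewrite [X in _ - (_ + X)]big_geq// addr0 exchange_big /= -sumrB -sumrN.
apply: eq_bigr => j _.
rewrite -[in RHS](big_mkord xpredT
  (fun i => (-1) ^+ i * ((-1) ^+ j * E j i))).
rewrite [in RHS](big_cat_nat (n := j.+1))//=; last by rewrite ltnS ltnW.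
rewrite opprD; congr (_ + _).
  rewrite -sumrN; apply: eq_bigr => i _.
  by rewrite addnS exprS mulN1r mulNr exprD mulrA.
by congr (- _); apply: eq_bigr => i _; rewrite /G exprD mulrA.
Qed.

Section Homotopy.
Variables (R : realType) (A : comNzRingType) (X Y : topologicalType).
Variable H : X * R -> Y.
Hypothesis Hc : {within [set: X] `*` `[0, 1], continuous H}.

(* [th] is the vertex map to the simplex of [X], and [p] selects the vertices at
   time [1] *)
Definition prism_fun m n (s : sing_simplex R n X) (th : 'I_m.+1 -> 'I_n.+1)
    (p : pred 'I_m.+1) (t : simplex R m) : Y :=
  H (s (push th t), \sum_(l | p l) val t 0 l).

Lemma prism_fun_continuous m n (s : sing_simplex R n X)
    (th : 'I_m.+1 -> 'I_n.+1) (p : pred 'I_m.+1) :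
  continuous (prism_fun s th p).
Proof.
have mem t : (s (push th t), \sum_(l | p l) val t 0 l)
    \in [set: X] `*` `[0, 1]%classic.
  by rewrite inE; split=> //; exact: sum_simplex_itv.
pose ph (t : simplex R m) : [set: X] `*` `[0, 1]%classic :=
    exist (fun z => z \in [set: X] `*` `[0, 1]%classic) _ (mem t).
have cph : continuous ph.
  apply: continuous_comp_initial => t.
  have cs : {for t, continuous (s \o push th)}.
    by apply: continuous_comp; [exact: push_continuous|exact: cts_fun].
  exact: (cvg_pair cs (@sum_simplex_continuous R m p t)).
move/subspace_sigL_continuousP : Hc => cH t.
exact: (continuous_comp (cph t) (cH (ph t))).
Qed.

Definition prism_simplex m n (s : sing_simplex R n X) th p :
    sing_simplex R m Y :=
  mkcts (@prism_fun_continuous m n s th p).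

Lemma prism_simplex_eq m n (s : sing_simplex R n X)
    (th th' : 'I_m.+1 -> 'I_n.+1) (p p' : pred 'I_m.+1) :
  th =1 th' -> p =1 p' -> prism_simplex s th p = prism_simplex s th' p'.
Proof. by move=> /funext-> /funext->. Qed.

Lemma prism_simplex_face m n (s : sing_simplex R n X)
    (th : 'I_m.+2 -> 'I_n.+1) p i :
  prism_simplex s th p \o face i =
  prism_simplex s (th \o lift i) (p \o lift i) :> sing_simplex R m Y.
Proof.
apply/continuousEP => t.
by rewrite /= /mkcts /prism_fun faceE push_comp push_sum.
Qed.

Lemma prism_simplex_of_face m n (s : sing_simplex R n.+1 X)
    (th : 'I_m.+1 -> 'I_n.+1) p i :
  prism_simplex (s \o face i) th p = prism_simplex s (lift i \o th) p.
Proof.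
by apply/continuousEP => t; rewrite /= /mkcts /prism_fun /= faceE push_comp.
Qed.

Definition prism n (c : cochain R A n.+1 Y) : cochain R A n X := fun s =>
  \sum_(j < n.+1)
    (-1) ^+ j *
    c (prism_simplex s (fun l => inord (unbump j l)) (fun l => (j < l)%N)).

Lemma prism0 n : @prism n 0 = 0.
Proof. by apply/funext => s; rewrite /prism big1// => j _; rewrite mulr0. Qed.

Definition prism_end n (b : bool) (c : cochain R A n Y) : cochain R A n X :=
  fun s => c (prism_simplex s id (fun=> b)).

Let D n (c : cochain R A n Y) (s : sing_simplex R n X) (i j : nat) : A :=
  c (prism_simplex s (fun l => inord (unbump j (bump i l)))
      (fun l => (j < bump i l)%N)).

Let E n (c : cochain R A n.+1 Y) (s : sing_simplex R n.+1 X) (j i : nat) : A :=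
  c (prism_simplex s (fun l => inord (bump i (unbump j l)))
      (fun l => (j < l)%N)).

Let D0 n c s : @D n c s 0 0 = prism_end true c s.
Proof.
congr c; apply: prism_simplex_eq => l //.
by rewrite /bump /unbump /= subn1 inord_val.
Qed.

Let D1 n c s : @D n c s n.+1 n = prism_end false c s.
Proof.
congr c; apply: prism_simplex_eq => l; have := ltn_ord l.
  move=> ln; rewrite (_ : unbump _ _ = l) ?inord_val//.
  by move: ln; rewrite /bump /unbump; lia.
by rewrite /bump; lia.
Qed.

Let prism_codiffD n (c : cochain R A n Y) s :
  prism (codiff c) s =
  \sum_(j < n.+1) (-1) ^+ j * (\sum_(i < n.+2) (-1) ^+ i * D c s i j).
Proof.
apply: eq_bigr => j _; congr (_ * _); apply: eq_bigr => i _; congr (_ * c _).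
by rewrite prism_simplex_face.
Qed.

Let codiff_prismE n (c : cochain R A n.+1 Y) s :
  codiff (prism c) s =
  \sum_(i < n.+2) (-1) ^+ i * (\sum_(j < n.+1) (-1) ^+ j * E c s j i).
Proof.
apply: eq_bigr => i _; congr (_ * _); apply: eq_bigr => j _; congr (_ * c _).
rewrite prism_simplex_of_face; apply: prism_simplex_eq => // l /=.
apply: val_inj; rewrite /= !inordK//.
all: move: (ltn_ord l) (ltn_ord i) (ltn_ord j); rewrite /bump /unbump; lia.
Qed.

Let Deq n c s j : @D n c s j.+1 j.+1 = @D n c s j.+1 j.
Proof.
by congr c; apply: prism_simplex_eq => l; [congr inord|];
  rewrite /bump /unbump; lia.
Qed.

Let Dlt n c s i j : (i < j)%N -> @D n.+1 c s i j = E c s j.-1 i.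
Proof.
by move=> ij; congr c; apply: prism_simplex_eq => l /=; [congr inord|];
  move: ij; rewrite /bump /unbump; lia.
Qed.

Let Dgt n c s i j : (j.+1 < i)%N -> @D n.+1 c s i j = E c s j i.-1.
Proof.
by move=> ij; congr c; apply: prism_simplex_eq => l /=; [congr inord|];
  move: ij; rewrite /bump /unbump; lia.
Qed.

Lemma prism_codiff0 (c : cochain R A 0 Y) :
  prism (codiff c) = prism_end true c - prism_end false c.
Proof.
apply/funext => s; rewrite prism_codiffD.
rewrite big_ord_recl big_ord0 big_ord_recl big_ord_recl big_ord0 /= !expr0.
rewrite !addr0 !mul1r expr1 mulN1r D0; congr (_ - _); exact: D1.
Qed.

Lemma prism_codiffS n (c : cochain R A n.+1 Y) :
  prism (codiff c) = prism_end true c - prism_end false c - codiff (prism c).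
Proof.
apply/funext => s; rewrite prism_codiffD.
rewrite (@prism_sum A _ (E c s))// ?D0 ?D1 -?codiff_prismE//.
- exact: Dlt.
- exact: Dgt.
Qed.

End Homotopy.

Section HomotopyInvariance.
Variables (R : realType) (A : comNzRingType).

Lemma cohomology_map_homotopic (X Y : topologicalType)
    (f g : continuousType X Y) n (h : cohomology R A Y n) :
  homotopic R f g -> cohomology_map f h = cohomology_map g h.
Proof.
move=> [H [Hc H0 H1]]; apply/eq_cohomology.
set z := repr h.
have zc : codiff (val z) = 0 by apply/asboolP/(valP z).
have endE : cochain_map f (val z) - cochain_map g (val z) =
    prism_end Hc false (val z) - prism_end Hc true (val z).
  apply/funext => s; congr (val z _ - val z _); apply/continuousEP => t /=.
    by rewrite /mkcts /prism_fun push_id big_pred0_eq H0.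
  rewrite /mkcts /prism_fun push_id -H1; congr (H (_, _)).
  by case: t => t /= /[!inE] -[].
case: n => [|n] in h z zc endE *.
  rewrite unfold_in /=; apply/eqP/val_inj; rewrite [LHS]endE.
  by rewrite -opprB -(prism_codiff0 Hc) zc prism0 oppr0.
apply/asboolP; exists (- prism Hc (val z)); rewrite [LHS]endE linearN /=.
apply/eqP; rewrite -opprB eqr_opp -subr_eq0 -(prism_codiffS Hc) zc.
by rewrite prism0.
Qed.

Lemma cohomology_map_cancel (X Y : topologicalType) (f : continuousType X Y)
    (g : continuousType Y X) n :
  cancel g f ->
  cancel (cohomology_map f : cohomology R A Y n -> _) (cohomology_map g).
Proof.
move=> gK; elim/quotW => z.
rewrite (cohomology_map_pi f z) cohomology_map_pi; congr \pi.
apply/val_inj/funext => s. apply: (congr1 (sval z)).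
by apply/continuousEP => t /=; rewrite gK.
Qed.

Lemma cohomology_map_id (X : topologicalType) n (h : cohomology R A X n) :
  cohomology_map idfun h = h.
Proof.
elim/quotW: h => z; rewrite cohomology_map_pi; congr \pi.
by apply/val_inj/funext => s; apply: (congr1 (sval z)); apply/continuousEP.
Qed.

End HomotopyInvariance.

Section ContinuousMatrix.
Variables (K : numFieldType) (T : topologicalType).

Lemma continuous_entry m n (f : T -> 'M[K]_(m, n)) i j :
  continuous f -> continuous (fun x => f x i j).
Proof.
move=> cf x; apply: (@continuous_comp _ _ _ f (fun M : 'M[K]_(m, n) => M i j)).
  exact: cf.
exact: coord_continuous.
Qed.

Lemma continuous_mulr (f g : T -> K) :
  continuous f -> continuous g -> continuous (fun x => f x * g x).
Proof. by move=> cf cg x; apply: continuousM; [exact: cf|exact: cg]. Qed.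

Lemma continuous_addr (f g : T -> K) :
  continuous f -> continuous g -> continuous (fun x => f x + g x).
Proof. by move=> cf cg x; apply: continuousD; [exact: cf|exact: cg]. Qed.

Lemma continuous_sum (I : Type) (r : seq I) (p : pred I) (f : I -> T -> K) :
  (forall i, continuous (f i)) ->
  continuous (fun x => \sum_(i <- r | p i) f i x).
Proof.
move=> cf; apply: continuous_big => [|i _]; last exact: cf.
exact: add_continuous.
Qed.

Lemma continuous_prod (I : Type) (r : seq I) (p : pred I) (f : I -> T -> K) :
  (forall i, continuous (f i)) ->
  continuous (fun x => \prod_(i <- r | p i) f i x).
Proof.
move=> cf; apply: continuous_big => [|i _]; last exact: cf.
exact: mul_continuous.
Qed.

Lemma continuous_mulmx m n p (f : T -> 'M[K]_(m, n)) (g : T -> 'M[K]_(n, p)) :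
  continuous f -> continuous g -> continuous (fun x => f x *m g x).
Proof.
move=> cf cg; apply: continuous_matrix => i j.
under [X in continuous X]eq_fun do rewrite mxE.
by apply: continuous_sum => k; apply: continuous_mulr; exact: continuous_entry.
Qed.

Lemma continuous_submx m n p q (h : 'M[K]_(m, n) -> 'M[K]_(p, q))
    (r : 'I_p -> 'I_q -> 'I_m) (c : 'I_p -> 'I_q -> 'I_n)
    (f : T -> 'M[K]_(m, n)) :
  (forall A i j, h A i j = A (r i j) (c i j)) ->
  continuous f -> continuous (fun x => h (f x)).
Proof.
move=> hE cf; apply: continuous_matrix => i j.
by under [X in continuous X]eq_fun do rewrite hE; exact: continuous_entry.
Qed.

Lemma continuous_lsubmx m n p (f : T -> 'M[K]_(m, n + p)) :
  continuous f -> continuous (fun x => lsubmx (f x)).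
Proof. by apply: continuous_submx => A i j; rewrite mxE. Qed.

Lemma continuous_rsubmx m n p (f : T -> 'M[K]_(m, n + p)) :
  continuous f -> continuous (fun x => rsubmx (f x)).
Proof. by apply: continuous_submx => A i j; rewrite mxE. Qed.

Lemma continuous_col m n (f : T -> 'M[K]_(m, n)) j :
  continuous f -> continuous (fun x => col j (f x)).
Proof. by apply: continuous_submx => A i k; rewrite mxE. Qed.

Lemma continuous_det n (f : T -> 'M[K]_n) :
  continuous f -> continuous (fun x => \det (f x)).
Proof.
move=> cf; apply: continuous_sum => s; apply: continuous_mulr.
  exact: cst_continuous.
by apply: continuous_prod => i; exact: continuous_entry.
Qed.

Lemma continuous_adj n (f : T -> 'M[K]_n) :
  continuous f -> continuous (fun x => \adj (f x)).
Proof.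
move=> cf; apply: continuous_matrix => i j.
under [X in continuous X]eq_fun do rewrite mxE.
apply: continuous_mulr; first exact: cst_continuous.
apply: continuous_det; apply: continuous_matrix => k l.
by under [X in continuous X]eq_fun do rewrite !mxE; exact: continuous_entry.
Qed.

End ContinuousMatrix.

Section Frames.
Variables (K : fieldType) (n : nat).

Definition col_prop m p (V W : 'M[K]_(m, p)) :=
  exists2 d : 'rV_p, forall i, d 0 i != 0 & W = V *m diag_mx d.

Definition std_frame : 'M[K]_(n, n + 1) := row_mx 1%:M (const_mx 1).

Definition frame_coef (W : 'M[K]_(n, n + 1)) : 'cV[K]_n :=
  \adj (lsubmx W) *m rsubmx W.

(* sends the standard frame to the columns of [W], up to scalars; the adjugate
   makes it polynomial in the entries of [W] *)
Definition frame_mx (W : 'M[K]_(n, n + 1)) : 'M[K]_n :=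
  lsubmx W *m diag_mx (frame_coef W)^T.

Lemma diag_mx_ones (d : 'rV[K]_n) : diag_mx d *m const_mx 1 = d^T.
Proof. by apply/colP => i; rewrite mul_diag_mx !mxE mulr1. Qed.

Lemma frame_mx_std (W : 'M[K]_(n, n + 1)) :
  frame_mx W *m std_frame =
  W *m diag_mx (row_mx (frame_coef W)^T (\det (lsubmx W))%:M).
Proof.
rewrite mul_mx_row mulmx1 -mulmxA diag_mx_ones trmxK mulmxA mul_mx_adj.
rewrite mul_scalar_mx /frame_mx.
move: (frame_coef W) (\det _) => c e; rewrite -[W in RHS]hsubmxK.
rewrite diag_mx_row mul_row_block !mulmx0 addr0 add0r; congr row_mx.
by apply/colP => i; rewrite mul_mx_diag !mxE eqxx mulr1n mulrC.
Qed.

Lemma frame_mx_prop (W : 'M[K]_(n, n + 1)) :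
  \det (lsubmx W) != 0 -> (forall i, frame_coef W i 0 != 0) ->
  frame_mx W \in unitmx /\ col_prop W (frame_mx W *m std_frame).
Proof.
move=> W0 c0; split.
  rewrite unitmxE det_mulmx det_diag unitfE mulf_neq0//.
  by apply/prodf_neq0 => i _; rewrite mxE.
rewrite frame_mx_std; eexists; last by [].
move=> i; rewrite -(splitK i); case: (fintype.split i) => j /=.
  by rewrite row_mxEl mxE.
by rewrite row_mxEr mxE ord1 eqxx.
Qed.

Lemma frame_uniq (P Q : 'M[K]_n) : (0 < n)%N -> P \in unitmx ->
  col_prop (P *m std_frame) (Q *m std_frame) -> exists2 c, c != 0 & Q = c *: P.
Proof.
move=> n0 uP [d d0].
rewrite -[d]hsubmxK !mul_mx_row !mulmx1 diag_mx_row mul_row_block.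
rewrite !mulmx0 addr0 add0r.
move=> /eq_row_mx[QE]; rewrite QE => /(congr1 (mulmx (invmx P))).
rewrite -!mulmxA !mulKmx// diag_mx_ones => dE.
exists (d 0 (rshift n 0)); first exact: d0.
rewrite -mul_mx_scalar; congr (P *m _); rewrite -diag_const_mx; congr diag_mx.
apply/rowP => i; move/colP/(_ i): dE.
by rewrite !mxE big_ord1 !mxE mul1r.
Qed.

End Frames.

Arguments std_frame {K n}.

Arguments nonzero_vec : clear implicits.
Arguments GL : clear implicits.

Lemma set_type_nbhs (X Y : topologicalType) (A : set X) (f : A -> Y) (u : A)
    (U : set Y) :
  continuous f -> nbhs (f u) U ->
  exists2 Q : set X, nbhs (val u) Q & forall w, Q (val w) -> U (f w).
Proof.
move=> cf /cf; case=> _ /= [] [W oW <- /= Wu sWU].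
exists W; last by move=> w Ww; exact: sWU.
by apply: open_nbhs_nbhs; split.
Qed.

Lemma col_mulmx (A : pzSemiRingType) m n p (M : 'M[A]_(m, n))
    (N : 'M[A]_(n, p)) j :
  col j (M *m N) = M *m col j N.
Proof. by rewrite !colE mulmxA. Qed.

Section ProjSpace.
Variable K : numFieldType.

Lemma scale_vec_subproof n (c : K) (u : nonzero_vec K n) :
  c != 0 -> c *: val u \in nonzero_vec K n.
Proof.
move=> c0; have /[!inE] u0 := valP u.
by rewrite /nonzero_vec /= scaler_eq0 negb_or c0.
Qed.

Definition scale_vec n (c : K) (c0 : c != 0) (u : nonzero_vec K n) :
    nonzero_vec K n :=
  exist (fun v => v \in nonzero_vec K n) _ (scale_vec_subproof u c0).

Lemma pi_scale_vec n (c : K) (c0 : c != 0) (u : nonzero_vec K n.+1) :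
  \pi_(proj_space K n) (scale_vec c0 u) = \pi_(proj_space K n) u.
Proof.
apply/proj_spaceE/asboolP; exists c^-1; first by rewrite invr_eq0.
by rewrite /= scalerA mulVf// scale1r.
Qed.

Lemma proj_pi_nbhs n (u : nonzero_vec K n.+1) (P : set 'cV[K]_n.+1) :
  nbhs (val u) P ->
  \forall p \near \pi_(proj_space K n) u,
    exists2 w : nonzero_vec K n.+1, P (val w) & \pi_(proj_space K n) w = p.
Proof.
rewrite nbhsE => -[W [oW Wu] WP].
pose V : set (proj_space K n) := [set p |
  exists2 w : nonzero_vec K n.+1, W (val w) & \pi_(proj_space K n) w = p].
have Vu : V (\pi_(proj_space K n) u) by exists u.
have oV : open V.
  rewrite /open /= /quotient_open.
  rewrite (_ : _ @^-1` _ = \bigcup_(c in [set c : K | c != 0])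
    ((fun w : nonzero_vec K n.+1 => c *: val w) @^-1` W)); last first.
    apply/seteqP.
    split=> [w [w' Ww' /proj_spaceE/asboolP[c c0 ww']]|w [c /= c0 Ww]].
      exists c^-1; first by rewrite /= invr_eq0.
      by rewrite /= ww' scalerA mulVf// scale1r.
    by exists (scale_vec c0 w) => //; exact: pi_scale_vec.
  have scale_c c : continuous (fun v : 'cV[K]_n.+1 => c *: v).
    apply: continuous_matrix => i j.
    under [X in continuous X]eq_fun do rewrite mxE.
    by apply: continuous_mulr; [exact: cst_continuous|exact: coord_continuous].
  apply: bigcup_open => c _; apply: open_comp oW => w _.
  exact: (continuous_comp (@initial_continuous _ _ val w) (scale_c c _)).
apply: filterS (open_nbhs_nbhs (conj oV Vu)) => p [w Ww <-].
by exists w => //; exact: WP.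
Qed.

(* the columns of [W] are homogeneous coordinates of the points of [x] *)
Definition lifts (W : 'M[K]_(3, 3 + 1)) (x : F4 K) := forall i : 'I_4,
  exists2 u : nonzero_vec K 3,
    val u = col i W & \pi_(proj_space K 2) u = val x i.

Lemma lifts_ex x : exists W, lifts W x.
Proof.
exists (\matrix_(k, i) val (repr (val x i)) k 0) => i.
exists (repr (val x i)); last by rewrite reprK.
by apply/colP => k; rewrite !mxE.
Qed.

Lemma lifts_inj W x y : lifts W x -> lifts W y -> x = y.
Proof.
move=> Wx Wy; apply/val_inj/funext => i.
have [u uW <-] := Wx i; have [v vW <-] := Wy i.
by congr \pi; apply: val_inj; rewrite uW vW.
Qed.

Lemma lifts_col_prop V W x : lifts V x -> lifts W x <-> col_prop V W.
Proof.
move=> Vx; split=> [Wx|[d d0 ->] i].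
  have /fin_all_exists[d dP] (i : 'I_4) :
      exists c : K, c != 0 /\ col i W = c *: col i V.
    have [u uV ux] := Vx i; have [w wW] := Wx i.
    rewrite -ux => /esym/proj_spaceE/asboolP[c c0 wu].
    by exists c; rewrite -wW -uV.
  exists (\row_i d i) => [i|]; first by rewrite mxE; have [] := dP i.
  apply/matrixP => k i; rewrite mul_mx_diag !mxE mulrC.
  by have [_ /colP/(_ k)] := dP i; rewrite !mxE.
have [u uV ux] := Vx i.
exists (scale_vec (d0 i) u); last by rewrite pi_scale_vec.
by rewrite /= uV; apply/colP => k; rewrite mul_mx_diag !mxE mulrC.
Qed.

Lemma lifts_act (A : GL K 3) W x :
  lifts W x -> lifts (val A *m W) (F4_act (\pi_(PGL K 3) A) x).
Proof.
move=> Wx i; have [u uW ux] := Wx i; exists (GL_act A u).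
  by rewrite /= uW col_mulmx.
by rewrite /= -ux PGL_act_pi.
Qed.

Lemma lifts_noncollinear W x (i j k : 'I_(3 + 1)) (l : 'rV[K]_3) :
  lifts W x -> uniq [:: i; j; k] ->
  l *m col i W = 0 -> l *m col j W = 0 -> l *m col k W = 0 -> l = 0.
Proof.
move=> Wx ijk li lj lk; apply/eqP/negPn/negP => l0.
have /[!inE] -[_ /(_ i j k ijk)] : val x \in F4 K := valP x.
apply; exists l => //; split.
- by have [u uW <-] := Wx i; apply/proj_line_pi; rewrite uW.
- by have [u uW <-] := Wx j; apply/proj_line_pi; rewrite uW.
- by have [u uW <-] := Wx k; apply/proj_line_pi; rewrite uW.
Qed.

Lemma lifts_frame W x : lifts W x ->
  frame_mx W \in unitmx /\ lifts (frame_mx W *m std_frame) x.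
Proof.
move=> Wx.
have W0 : \det (lsubmx W) != 0.
  apply/negP => /det0P[l l0 lW]; move/eqP: l0; apply.
  have lc (i : 'I_3) : l *m col (lshift 1 i) W = 0.
    by rewrite -[W]hsubmxK colKl -col_mulmx lW col0.
  exact: (lifts_noncollinear Wx _ (lc 0) (lc 1) (lc ord_max)).
have c0 i : frame_coef W i 0 != 0.
  (* otherwise the [i]-th row of the adjugate, as a linear form, would vanish at
     the last point and at two of the first three *)
  apply/eqP => ci; pose l := row i (\adj (lsubmx W)).
  have lA : l *m lsubmx W = row i (\det (lsubmx W))%:M.
    by rewrite -row_mul mul_adj_mx.
  have lW j : j != i -> l *m col (lshift 1 j) W = 0.
    move=> ji; rewrite -[in LHS](hsubmxK W) colKl -col_mulmx lA.
    by apply/matrixP => a b; rewrite !mxE eq_sym (negPf ji).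
  have lV : l *m col (rshift 3 0) W = 0.
    rewrite -[in LHS](hsubmxK W) colKr -col_mulmx -row_mul.
    by apply/matrixP => a b; rewrite !ord1 mxE [in LHS]mxE ci mxE.
  have [j [k [ji ki jk]]] : exists j k, [/\ j != i, k != i & j != k].
    case: i {ci l lA lW lV} => -[|[|[|//]]] i.
    - by exists 1, ord_max.
    - by exists 0, ord_max.
    - by exists 0, 1.
  have l0 : l = 0.
    apply: (lifts_noncollinear Wx _ (lW j ji) (lW k ki) lV).
    by rewrite /= !inE !eq_lrshift orbF eq_lshift jk.
  move/negP: W0; apply; move/rowP/(_ i): lA.
  by rewrite l0 mul0mx !mxE eqxx => /esym/eqP.
have [uM WM] := frame_mx_prop W0 c0; split=> //.
exact/(lifts_col_prop _ Wx).
Qed.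

Lemma F4_near_lift (x : F4 K) V (P : set 'M[K]_(3, 3 + 1)) :
  lifts V x -> nbhs V P ->
  \forall y \near x, exists2 W, lifts W y & P W.
Proof.
move=> Vx [Q QV QP].
pose N (i : 'I_4) : set 'cV[K]_3 := [set v | forall k, Q k i (v k 0)].
pose S (i : 'I_4) : set (F4 K) := [set y | exists2 w : nonzero_vec K 3,
  N i (val w) & \pi_(proj_space K 2) w = val y i].
have near_i i : \forall y \near x, S i y.
  have [u uV ux] := Vx i.
  have Nu : nbhs (val u) (N i).
    exists (fun k _ => Q k i) => [k j|v Nv k]; last exact: Nv.
    by rewrite uV mxE.
  have := proj_pi_nbhs Nu; rewrite ux; exact: (@F4_coord_continuous K i x).
have near_all := @filter_forall _ _ S _ (nbhs_filter x) near_i.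
apply: (@filterS _ _ (nbhs_filter x) _ _ _ near_all) => y.
move=> /fin_all_exists2[w Nw wy].
exists (\matrix_(k, i) val (w i) k 0) => [i|].
  by exists (w i) => //; apply/colP => k; rewrite !mxE.
by apply: QP => k i; rewrite mxE; exact: Nw.
Qed.

End ProjSpace.

Section Path.
Variable R : realType.
Local Notation C := (R[i] : numFieldType).

Lemma real_complex_continuous : continuous (real_complex R : R -> C).
Proof.
move=> x; apply/cvgrPdist_lt => e e0; have /complex_realP[d de] := gtr0_real e0.
have d0 : 0 < d by rewrite -ltcR -de.
near=> t; rewrite de -[_ - _]rmorphB normc_def /= expr0n addr0 sqrtr_sqr ltcR.
by near: t; apply: cvgr_dist_lt.
Unshelve. all: by end_near.
Qed.

Lemma complex_continuous (a b : R -> R) :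
  continuous a -> continuous b ->
  continuous ((fun t => Complex (a t) (b t)) : R -> C).
Proof.
move=> ca cb.
rewrite (_ : (fun t => _) = fun t => (a t)%:C%C + 'i%C * (b t)%:C%C);
  last first.
  by apply/funext => t; rewrite [LHS]complexE.
have cC (f : R -> R) :
    continuous f -> continuous ((fun t => (f t)%:C%C) : R -> C).
  by move=> cf t; apply: (continuous_comp (cf t));
    exact: real_complex_continuous.
apply: continuous_addr; first exact: cC.
by apply: continuous_mulr; [exact: cst_continuous|exact: cC].
Qed.

(* The determinant of [(1 - z) B + z] is a nonzero polynomial in [z], and the
   arcs [z = t + i s t (1 - t)], for [s] a natural number, only meet at [0] and
   [1], so that one of them avoids its roots. *)
Lemma GL_path n (B : 'M[C]_n) : B \in unitmx ->
  exists g : R -> 'M[C]_n, [/\ continuous g, g 0 = B, g 1 = 1%:M &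
    forall t, g t \in unitmx].
Proof.
move=> uB; pose G (z : C) : 'M[C]_n := B + z *: (1%:M - B).
pose p : {poly C} := \det (map_mx polyC B + 'X *: map_mx polyC (1%:M - B)).
have pE z : p.[z] = \det (G z).
  rewrite -horner_evalE -det_map_mx; congr (\det _).
  by apply/matrixP => i j; rewrite !mxE -[LHS]/((_ + _).[z]) !hornerE.
have G0 : G 0 = B by rewrite /G scale0r addr0.
have G1 : G 1 = 1%:M by rewrite /G scale1r addrC subrK.
have p0 : p.[0] != 0 by rewrite pE G0 -unitfE -unitmxE.
have p1 : p.[1] != 0 by rewrite pE G1 det1 oner_eq0.
pose arc (s : nat) (t : R) : C := Complex t (s%:R * (t * (1 - t))).
have arc0 s : arc s 0 = 0 by rewrite /arc mul0r mulr0.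
have arc1 s : arc s 1 = 1 by rewrite /arc subrr !mulr0.
have [s sP] : exists s, forall t, p.[arc s t] != 0.
  apply: contrapT => /forallNP noarc.
  have /choice[t tP] (s : nat) : exists t, p.[arc s t] = 0.
    by have /existsNP[t /negP/negPn/eqP] := noarc s; exists t.
  have arc_inj : injective (fun s => arc s (t s)).
    move=> s s' [tt']; rewrite -tt' => /mulIf ss'; apply/eqP.
    rewrite -(eqr_nat R); apply/eqP/ss'; rewrite mulf_neq0//.
      by apply: contraNneq p0 => t0; rewrite -[X in _ == X](tP s) t0 arc0.
    rewrite subr_eq0; apply: contraNneq p1 => t1.
    by rewrite -[X in _ == X](tP s) -t1 arc1.
  have p_neq0 : p != 0 by apply: contraNneq p0 => ->; rewrite horner0.
  pose rs := [seq arc s (t s) | s <- iota 0 (size p)].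
  suff : (size rs < size p)%N by rewrite size_map size_iota ltnn.
  apply: max_poly_roots => //; last by rewrite map_inj_uniq// iota_uniq.
  by apply/allP => _ /mapP[s _ ->]; apply/eqP.
exists (fun t => G (arc s t)); split.
- apply: continuous_matrix => i j.
  under [X in continuous X]eq_fun do rewrite !mxE.
  have c_arc : continuous (arc s).
    apply: complex_continuous; first by move=> t; exact: cvg_id.
    apply: continuous_mulr; first exact: cst_continuous.
    apply: continuous_mulr; first by move=> t; exact: cvg_id.
    by move=> t; apply: continuousB; [exact: cst_continuous|exact: cvg_id].
  apply: continuous_addr; first exact: cst_continuous.
  by apply: continuous_mulr; [exact: c_arc|exact: cst_continuous].
- by rewrite arc0.
- by rewrite arc1.
- by move=> t; rewrite unitmxE -pE unitfE.
Qed.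

End Path.

Section Orbit.
Variable K : numFieldType.

Lemma std_frame_noncollinear (i j k : 'I_(3 + 1)) (l : 'rV[K]_3) :
  uniq [:: i; j; k] -> l *m col i std_frame = 0 -> l *m col j std_frame = 0 ->
  l *m col k std_frame = 0 -> l = 0.
Proof.
pose L (a : 'I_(3 + 1)) := (l *m std_frame) 0 a.
have LE a : l *m col a std_frame = 0 -> L a = 0.
  by rewrite -col_mulmx => /colP/(_ 0); rewrite mxE /L => ->; rewrite mxE.
have Ll (a : 'I_3) : L (lshift 1 a) = l 0 a.
  by rewrite /L mul_mx_row row_mxEl mulmx1.
have Lr : L (rshift 3 0) = \sum_a L (lshift 1 a).
  rewrite /L mul_mx_row row_mxEr mxE; apply: eq_bigr => a _.
  by rewrite row_mxEl mulmx1 mxE mulr1.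
move=> ijk /LE Li /LE Lj /LE Lk.
suff L0 a : L a = 0 by apply/rowP => a; rewrite -Ll L0 mxE.
have [|aijk] := boolP (a \in [:: i; j; k]).
  by rewrite !inE => /or3P[] /eqP->.
pose e (b : 'I_(3 + 1)) : K := if fintype.split b is inl _ then 1 else -1.
have : \sum_b e b * L b = 0.
  rewrite big_split_ord big_ord1 Lr /=.
  rewrite (_ : e (rshift 3 0) = -1); last by rewrite /e (unsplitK (inr 0)).
  rewrite mulN1r; apply/eqP; rewrite subr_eq0; apply/eqP/eq_bigr => b _.
  by rewrite /e (unsplitK (inl b)) mul1r.
rewrite (bigD1 a)//= big1 ?addr0 => [/eqP|b ba].
  rewrite mulf_eq0 => /orP[|/eqP//].
  by rewrite /e; case: fintype.split; rewrite ?oppr_eq0 oner_eq0.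
have : b \in [:: i; j; k].
  move: ijk aijk ba; rewrite /= !inE -!val_eqE /=.
  by move: (ltn_ord i) (ltn_ord j) (ltn_ord k) (ltn_ord a) (ltn_ord b); lia.
by rewrite !inE => /or3P[] /eqP->; rewrite ?Li ?Lj ?Lk mulr0.
Qed.

Lemma std_frameEl n (a b : 'I_n) :
  (std_frame : 'M[K]_(n, n + 1)) a (lshift 1 b) = (a == b)%:R.
Proof. by rewrite row_mxEl mxE. Qed.

Lemma std_frameEr n (a : 'I_n) (b : 'I_1) :
  (std_frame : 'M[K]_(n, n + 1)) a (rshift n b) = 1.
Proof. by rewrite row_mxEr mxE. Qed.

Lemma std_vec_subproof (i : 'I_(3 + 1)) : col i std_frame \in nonzero_vec K 3.
Proof.
rewrite inE /nonzero_vec /=; apply/eqP => /colP E0.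
have {}E0 a : (std_frame : 'M[K]_(3, 3 + 1)) a i = 0.
  by have := E0 a; rewrite mxE => ->; rewrite mxE.
move: E0; rewrite -(splitK i); case: (fintype.split i) => b /= E0.
  by have /eqP := E0 b; rewrite std_frameEl eqxx oner_eq0.
by have /eqP := E0 0; rewrite std_frameEr oner_eq0.
Qed.

Definition std_vec (i : 'I_(3 + 1)) : nonzero_vec K 3 :=
  exist (fun v => v \in nonzero_vec K 3) _ (std_vec_subproof i).

Lemma std_point_subproof :
  (fun i : 'I_4 => \pi_(proj_space K 2) (std_vec i)) \in F4 K.
Proof.
rewrite inE; split=> [i j /proj_spaceE/asboolP[c c0]|i j k ijk [l l0]].
  move=> /colP ij; have {}ij a : (std_frame : 'M[K]_(3, 3 + 1)) a j =
      c * (std_frame : 'M[K]_(3, 3 + 1)) a i.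
    by have := ij a; rewrite [LHS]mxE [RHS]mxE [X in c * X]mxE.
  pose a (b : 'I_3) : 'I_3 := lift b ord0.
  have ab b : (a b == b) = false by rewrite eq_sym (negPf (neq_lift _ _)).
  move: ij; rewrite -(splitK (i : 'I_(3 + 1))) -(splitK (j : 'I_(3 + 1))).
  case: (fintype.split (i : 'I_(3 + 1))) => b;
    case: (fintype.split (j : 'I_(3 + 1))) => b' /= ij.
  - have := ij b'; rewrite !std_frameEl eqxx; case: eqP => [->//|_] /eqP.
    by rewrite mulr0 oner_eq0.
  - by have /eqP := ij (a b); rewrite std_frameEl std_frameEr ab mulr0 oner_eq0.
  - have := ij (a b'); rewrite std_frameEl std_frameEr ab mulr1 => /esym/eqP.
    by rewrite (negPf c0).
  - by rewrite !ord1.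
move=> [/proj_line_pi li /proj_line_pi lj /proj_line_pi lk].
by move/eqP: l0; apply; exact: (std_frame_noncollinear ijk li lj lk).
Qed.

Definition std_point : F4 K :=
  exist (fun x => x \in F4 K) _ std_point_subproof.

Lemma lifts_std_point : lifts std_frame std_point.
Proof. by move=> i; exists (std_vec i). Qed.

Definition GL_of n (A : 'M[K]_n) (uA : A \in unitmx) : GL K n :=
  exist (fun B => B \in GL K n) A (mem_set uA).

Lemma GL_unit n (A : GL K n) : val A \in unitmx.
Proof. by have /[!inE] := valP A. Qed.

Lemma frame_ex (x : F4 K) : exists A : GL K 3, lifts (val A *m std_frame) x.
Proof.
have [W Wx] := lifts_ex x; have [uA Ax] := lifts_frame Wx.
by exists (GL_of uA).
Qed.

Definition frame (x : F4 K) : GL K 3 := sval (cid (frame_ex x)).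

Lemma frameP x : lifts (val (frame x) *m std_frame) x.
Proof. exact: svalP (cid (frame_ex x)). Qed.

Lemma lifts_GL_uniq (A B : GL K 3) x :
  lifts (val A *m std_frame) x -> lifts (val B *m std_frame) x ->
  \pi_(PGL K 3) A = \pi_(PGL K 3) B.
Proof.
move=> Ax /(lifts_col_prop _ Ax) /frame_uniq[] //; first exact: GL_unit.
by move=> c c0 AB; apply/PGLE/asboolP; exists c.
Qed.

Lemma orbit_map_inj x : injective (orbit_map x : PGL K 3 -> F4 K).
Proof.
elim/quotW => A; elim/quotW => B AB.
have Ax := lifts_act A (frameP x).
have Bx := lifts_act B (frameP x); rewrite -[F4_act _ _]AB in Bx.
move/(lifts_col_prop _ Ax): Bx; rewrite !mulmxA => /frame_uniq[] //.
  by rewrite unitmx_mul !GL_unit.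
move=> c c0; rewrite scalemxAl => /(can_inj (mulmxK (GL_unit _))) BA.
by apply/PGLE/asboolP; exists c.
Qed.

Lemma unit_frame_div (x y : F4 K) :
  val (frame y) *m invmx (val (frame x)) \in unitmx.
Proof. by rewrite unitmx_mul unitmx_inv !GL_unit. Qed.

Definition orbit_inv (x y : F4 K) : PGL K 3 :=
  \pi_(PGL K 3) (GL_of (unit_frame_div x y)).

Lemma orbit_invK x : cancel (orbit_inv x) (orbit_map x).
Proof.
move=> y; apply: lifts_inj (frameP y).
have := lifts_act (GL_of (unit_frame_div x y)) (frameP x).
by rewrite mulmxA /= mulmxKV ?GL_unit.
Qed.

Lemma orbit_mapK x : cancel (orbit_map x) (orbit_inv x).
Proof. by move=> g; apply: (@orbit_map_inj x); rewrite orbit_invK. Qed.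

Lemma pi_frame_mx W x (B : 'M[K]_3) : lifts W x -> B \in unitmx ->
  forall uWB : frame_mx W *m B \in unitmx,
  forall uxB : val (frame x) *m B \in unitmx,
  \pi_(PGL K 3) (GL_of uWB) = \pi_(PGL K 3) (GL_of uxB).
Proof.
move=> Wx uB uWB uxB; have [uW Wfx] := lifts_frame Wx.
have /PGLE/asboolP[c c0 /= xW] :=
  @lifts_GL_uniq (GL_of uW) (frame x) _ Wfx (frameP x).
by apply/PGLE/asboolP; exists c => //; rewrite /= xW -scalemxAl.
Qed.

Lemma continuous_frame_mx : continuous (@frame_mx K 3).
Proof.
have cid : continuous (@id 'M[K]_(3, 3 + 1)) by move=> W; exact: cvg_id.
apply: continuous_mulmx; first exact: continuous_lsubmx.
apply: continuous_matrix => i j.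
under [X in continuous X]eq_fun do rewrite 2!mxE.
rewrite (_ : (fun _ => _) = fun W => if i == j then frame_coef W i 0 else 0).
  case: eqP => _; last exact: cst_continuous.
  apply: continuous_entry.
  apply: continuous_mulmx; last exact: continuous_rsubmx.
  by apply: continuous_adj; exact: continuous_lsubmx.
by apply/funext => W; case: eqP.
Qed.

Lemma orbit_inv_continuous x : continuous (orbit_inv x).
Proof.
move=> y U; have [V Vy] := lifts_ex y; have [uV _] := lifts_frame Vy.
set N := invmx (val (frame x)).
have uN : N \in unitmx by rewrite unitmx_inv GL_unit.
have uM (W : 'M[K]_(3, 3 + 1)) :
    frame_mx W \in unitmx -> frame_mx W *m N \in unitmx.
  by move=> uW; rewrite unitmx_mul uW.
have invE W z (Wz : lifts W z) (uW : frame_mx W *m N \in unitmx) :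
    orbit_inv x z = \pi_(PGL K 3) (GL_of uW).
  exact/esym/pi_frame_mx.
rewrite (invE V y Vy (uM V uV)).
move=> /(set_type_nbhs (@pi_continuous _ _))[Q QV QU].
have cN : continuous (fun W : 'M[K]_(3, 3 + 1) => frame_mx W *m N).
  apply: continuous_mulmx; first exact: continuous_frame_mx.
  exact: cst_continuous.
apply: (@filterS _ _ (nbhs_filter y) _ _ _ (F4_near_lift Vy (cN V _ QV))).
move=> z [W Wz QW]; have [uW _] := lifts_frame Wz.
by rewrite /= (invE W z Wz (uM W uW)); exact: QU.
Qed.

End Orbit.

Section ActionHomotopy.
Variables (R : realType).
Local Notation C := (R[i] : numFieldType).

Lemma F4_permA (s : 'S_4) (g : PGL C 3) (x : F4 C) :
  F4_perm s (F4_act g x) = F4_act g (F4_perm s x).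
Proof. exact: val_inj. Qed.

Lemma F4_perm_homotopic (s : 'S_4) : homotopic R (F4_perm s) (@idfun (F4 C)).
Proof.
set e := std_point C.
have [g [cg g0 g1 ug]] := GL_path (GL_unit (frame (F4_perm s e))).
have uA x t : val (frame x) *m g t \in unitmx.
  by rewrite unitmx_mul GL_unit ug.
pose H (xt : F4 C * R) : F4 C :=
  F4_act (\pi_(PGL C 3) (GL_of (uA xt.1 xt.2))) e.
have HE W x t : lifts W x -> lifts (frame_mx W *m g t *m std_frame) (H (x, t)).
  move=> Wx; have [uW _] := lifts_frame Wx.
  have uWg : frame_mx W *m g t \in unitmx by rewrite unitmx_mul uW ug.
  rewrite /H -(pi_frame_mx Wx (ug t) uWg).
  exact: (lifts_act (GL_of uWg) (@lifts_std_point C)).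
have Hframe x t : lifts (val (frame x) *m g t *m std_frame) (H (x, t)).
  exact: (lifts_act (GL_of (uA x t)) (@lifts_std_point C)).
exists H; split=> [|x|x].
- apply: continuous_subspaceT.
  apply: continuous_comp_initial.
  apply: continuous_prod_topology => i [x t] U UH.
  have [V Vx] := lifts_ex x.
  have [u uV ux] := HE V x t Vx i.
  have : nbhs (\pi_(proj_space C 2) u) U by rewrite ux.
  move=> /(set_type_nbhs (@pi_continuous _ _))[Q]; rewrite uV => QV QU.
  pose F (Wt : 'M[C]_(3, 3 + 1) * R) :=
    col i (frame_mx Wt.1 *m g Wt.2 *m std_frame).
  have cF : continuous F.
    apply: continuous_col; apply: continuous_mulmx; last exact: cst_continuous.
    apply: continuous_mulmx => -[W r].
      apply: (continuous_comp (@cvg_fst _ _ _ _ _)).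
      exact: continuous_frame_mx.
    by apply: (continuous_comp (@cvg_snd _ _ _ _ _)); exact: cg.
  have [[P S] /= [PV St] PSQ] := cF (V, t) _ QV.
  exists ([set y | exists2 W, lifts W y & P W], S) => /=.
    by split=> //; exact: (F4_near_lift Vx PV).
  move=> [y r] /= [[W Wy PW] Sr].
  have [w wW wy] := HE W y r Wy i.
  have : U (\pi_(proj_space C 2) w).
    by apply: QU; rewrite wW; exact: (PSQ (W, r)).
  by rewrite wy.
- apply: lifts_inj (Hframe x 0) _; rewrite g0 -mulmxA.
  have xe : x = F4_act (\pi_(PGL C 3) (frame x)) e.
    exact: lifts_inj (frameP x) (lifts_act _ (@lifts_std_point C)).
  have -> : F4_perm s x = F4_act (\pi_(PGL C 3) (frame x)) (F4_perm s e).
    by rewrite -F4_permA -xe.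
  exact: lifts_act (frameP _).
- by apply: lifts_inj (Hframe x 1) _; rewrite g1 mulmx1; exact: frameP.
Qed.

End ActionHomotopy.

HB.instance Definition _ (K : numFieldType) (x : F4 K) :=
  isContinuous.Build _ _ (orbit_inv x) (@orbit_inv_continuous K x).

Theorem proposition2p5 (R : realType) :
  [/\ (forall s : 'S_4, homotopic R (F4_perm s) (@idfun (F4 R[i]))),
      (forall (x : F4 R[i]) (n : nat),
         bijective (cohomology_map (orbit_map x) :
           cohomology R rat (F4 R[i]) n -> cohomology R rat (PGL R[i] 3) n)) &
      (forall (s : 'S_4) (n : nat) (h : cohomology R rat (F4 R[i]) n),
         cohomology_map (F4_perm s) h = h)].
Proof.
split=> [s|x n|s n h].
- exact: F4_perm_homotopic.
- exists (cohomology_map (orbit_inv x)); apply: cohomology_map_cancel.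
    exact: orbit_invK.
  exact: orbit_mapK.
- rewrite (cohomology_map_homotopic _ (F4_perm_homotopic R s)).
  exact: cohomology_map_id.
Qed.
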